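(* Let $G$ be a weighted graph. Suppose that the edge lengths in each maximal $2$-connected component of $G$ are $\mathbb{Q}$-linearly independent (as a family indexed by the edges of that component). Then $J(G)$ is free Abelian of rank $\#V(G) - \#Br(G) - 1$, where $Br(G)$ is the set of bridges of $G$.
   Context: A weighted graph $G$ is a finite connected multigraph (loops and multiple edges allowed) with nonempty finite vertex set $V(G)$, finite edge set $E(G)$, a length function $\ell : E(G) \to \mathbb{R}_{>0}$, and a fixed orientation: each edge $e$ has a tail $e^-$ and a head $e^+$. For $A \in \{\mathbb{Z},\mathbb{R}\}$, $C_1(G,A)$ is the free $A$-module on $E(G)$. Let $(d^*\alpha)(x) = \sum_{e : e^+ = x}\alpha(e) - \sum_{e : e^-=x}\alpha(e)$ and $H_1(G,\mathbb{Z}) = \ker(d^* )\cap C_1(G,\mathbb{Z})$. A 1-form $\omega = \sum_e \omega_e\, de$ (formal real combination of symbols $de$, $e\in E(G)$) is harmonic if $\sum_{e: e^+=x}\omega_e = \sum_{e : e^-=x}\omega_e$ for all $x \in V(G)$; $\Omega(G)$ is the space of harmonic 1-forms. Integration is bilinear with $\int_{e'} de = \ell(e)$ if $e=e'$ and $0$ otherwise; each $\alpha\in C_1(G,\mathbb{R})$ gives $\int_\alpha \in \Omega(G)^*$. Put $\Omega(G)^\sharp = \{\int_\alpha : \alpha \in C_1(G,\mathbb{Z})\}$. The map $\alpha\mapsto\int_\alpha$ embeds $H_1(G,\mathbb{Z})$ in $\Omega(G)^\sharp$, and the Jacobian is $J(G) = \Omega(G)^\sharp / H_1(G,\mathbb{Z})$.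 A weighted graph is $2$-connected if its geometric realization (obtained by gluing segments $[0,\ell(e)]$ according to the endpoints of the edges) cannot be disconnected by deleting a single point; the maximal $2$-connected components of $G$ are its maximal $2$-connected subgraphs. A bridge is an edge not contained in any nontrivial cycle. *)

(* Defs.v *)
From HB Require Import structures.
From mathcomp Require Import all_boot all_order all_algebra.
From mathcomp Require Import all_classical all_reals.
From mathcomp Require Import topology normedtype.

Set Implicit Arguments.
Unset Strict Implicit.
Unset Printing Implicit Defensive.

Import Order.TTheory GRing.Theory Num.Theory.
Import numFieldNormedType.Exports.
Local Open Scope ring_scope.
Local Open Scope classical_set_scope.
Local Open Scope quotient_scope.

Definition adjacent (V E : finType) (tl hd : E -> V) : rel V :=
  fun x y => [exists e, ((tl e == x) && (hd e == y)) ||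
                        ((tl e == y) && (hd e == x))].

Record wgraph (R : realType) : Type := WGraph {
  vertex : finType;
  edge : finType;
  tail : edge -> vertex;
  head : edge -> vertex;
  len : edge -> R;
  len_gt0 : forall e, 0 < len e;
  vertex_nonempty : (0 < #|vertex|)%N;
  wgraph_connected : forall x y, connect (adjacent tail head) x y }.

Arguments vertex {R} w.
Arguments edge {R} w.
Arguments tail {R w}.
Arguments head {R w}.
Arguments len {R w}.

Section Realization.
Context {R : realType} (G : wgraph R).

(* One point for each vertex (needed when the graph has no edge) and one
   segment [0, len e] for each edge. *)
Definition cell (i : (vertex G + edge G)%type) : topologicalType :=
  match i with
  | inl _ => discrete_topology unit
  | inr e => set_type `[0, len e]%classic
  end.

Definition cells : topologicalType := {i & cell i}.

Definition vertex_cell (v : vertex G) : cells := existT cell (inl v) tt.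

Definition attach (x : cells) : cells :=
  match x with
  | existT (inl v) _ => vertex_cell v
  | existT (inr e) t =>
      if set_val t == 0 then vertex_cell (tail e)
      else if set_val t == len e then vertex_cell (head e)
      else existT cell (inr e) t
  end.

(* Since [attach] is idempotent, this is the equivalence relation generated by
   (e, 0) ~ tail e and (e, len e) ~ head e. *)
Definition glue : rel cells := fun x y => attach x == attach y.

Lemma glue_is_equiv : equiv_class_of glue.
Proof.
by split=> [x|x y|y x z]; rewrite /glue ?eqxx // 1?eq_sym // => /eqP->.
Qed.

Canonical glue_equiv := EquivRelPack glue_is_equiv.
Canonical glue_encModRel := defaultEncModRel glue.

Definition realization : topologicalType := quotient_topology {eq_quot glue}.

(* A graph with a single vertex and no edge is 2-connected: [connected set0]
   holds. *)
Definition two_connected : Prop :=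
  forall p : realization, connected [set~ p].

(* The pair (e, b) is the edge e traversed forward if b and backward if not. *)
Definition dart := (edge G * bool)%type.
Definition source (a : dart) := if a.2 then tail a.1 else head a.1.
Definition target (a : dart) := if a.2 then head a.1 else tail a.1.

(* A loop is a cycle of length 1, and two parallel edges make a cycle of
   length 2; [uniq (map fst c)] excludes going back and forth along one edge. *)
Definition is_cycle (c : seq dart) : bool :=
  [&& c != [::], cycle (fun a b => target a == source b) c,
      uniq (map source c) & uniq (map fst c)].

Definition is_bridge (e : edge G) : Prop :=
  ~ exists c : seq dart, is_cycle c /\ e \in map fst c.

Definition bridges : {set edge G} := [set e | `[< is_bridge e >]]%SET.

End Realization.

Record subgraph (R : realType) (G : wgraph R) : Type := Subgraph {
  svertex : {set vertex G};
  sedge : {set edge G};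
  sub_tail : forall e, e \in sedge -> tail e \in svertex;
  sub_head : forall e, e \in sedge -> head e \in svertex;
  svertex_nonempty : (0 < #|{: {v | v \in svertex}}|)%N;
  sub_connected : forall x y : {v | v \in svertex},
    connect (adjacent
      (fun e : {e | e \in sedge} => Sub (tail (val e)) (sub_tail (valP e)))
      (fun e : {e | e \in sedge} => Sub (head (val e)) (sub_head (valP e))))
      x y }.

Definition wgraph_of_subgraph (R : realType) (G : wgraph R) (H : subgraph G) :
    wgraph R :=
  @WGraph R {v | v \in svertex H} {e | e \in sedge H} _ _
    (fun e => len (val e)) (fun e => len_gt0 (val e))
    (svertex_nonempty H) (@sub_connected R G H).

Coercion wgraph_of_subgraph : subgraph >-> wgraph.

Definition sub_subgraph (R : realType) (G : wgraph R) (H K : subgraph G) :=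
  (svertex H \subset svertex K) && (sedge H \subset sedge K).

Definition maximal_two_connected (R : realType) (G : wgraph R)
    (H : subgraph G) : Prop :=
  two_connected H /\
  forall K : subgraph G,
    two_connected K -> sub_subgraph H K -> sub_subgraph K H.

Definition rat_independent (R : realType) (I : finType) (x : I -> R) : Prop :=
  forall q : I -> rat,
    \sum_i ratr (q i) * x i = 0 -> forall i, q i = 0.

Section Jacobian.
Context {R : realType} (G : wgraph R).

Definition dstar {A : zmodType} (alpha : {ffun edge G -> A}) :
    {ffun vertex G -> A} :=
  [ffun x => \sum_(e | head e == x) alpha e - \sum_(e | tail e == x) alpha e].

Definition in_H1 (alpha : {ffun edge G -> int}) : bool := dstar alpha == 0.

(* The 1-form \sum_e omega_e de is represented by e |-> omega_e. *)
Definition harmonic (omega : {ffun edge G -> R^o}) : bool :=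
  [forall x, \sum_(e | head e == x) omega e == \sum_(e | tail e == x) omega e].

Definition dstarR : {ffun edge G -> R^o} -> {ffun vertex G -> R^o} := dstar.

Lemma dstarR_is_linear : linear dstarR.
Proof.
move=> a u v; apply/ffunP => x; rewrite /dstarR /dstar !ffunE scalerBr.
rewrite !scaler_sumr addrACA -opprD -!big_split /=.
by congr (_ - _); apply: eq_bigr => e _; rewrite !ffunE.
Qed.

HB.instance Definition _ :=
  GRing.isLinear.Build R {ffun edge G -> R^o} {ffun vertex G -> R^o} *:%R
    dstarR dstarR_is_linear.

(* See [mem_Omega]: these are the harmonic 1-forms. *)
Definition Omega : {vspace {ffun edge G -> R^o}} := lker (linfun dstarR).

Lemma mem_Omega omega : (omega \in Omega) = harmonic omega.
Proof.
rewrite memv_ker lfunE /=; apply/eqP/forallP => [/ffunP h x|h].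
  by have := h x; rewrite !ffunE => /eqP; rewrite subr_eq0.
by apply/ffunP => x; rewrite !ffunE; apply/eqP; rewrite subr_eq0.
Qed.

(* R^o is R as a vector space over itself. *)
Definition Omega_dual : zmodType := 'Hom(subvs_of Omega, R^o).

Definition integrate (alpha : {ffun edge G -> R}) (omega : subvs_of Omega) :
    R^o :=
  \sum_e alpha e * vsval omega e * len e.

Lemma integrate_is_linear alpha : linear (integrate alpha).
Proof.
move=> a u v; rewrite /integrate scaler_sumr -big_split /=.
apply: eq_bigr => e _; rewrite !ffunE.
rewrite mulrDr mulrDl; congr (_ + _).
by rewrite /GRing.scale /= !mulrA (mulrC (alpha e) a).
Qed.

HB.instance Definition _ alpha :=
  GRing.isLinear.Build R (subvs_of Omega) R^o *:%R
    (integrate alpha) (integrate_is_linear alpha).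

Definition integral (alpha : {ffun edge G -> R}) : Omega_dual :=
  linfun (integrate alpha).

Lemma integralE alpha (omega : subvs_of Omega) :
  (integral alpha : 'Hom(subvs_of Omega, R^o)) omega =
  \sum_e alpha e * vsval omega e * len e.
Proof. exact: lfunE. Qed.

Definition integralZ (alpha : {ffun edge G -> int}) : Omega_dual :=
  integral [ffun e => (alpha e)%:~R].

Lemma integralZ_is_additive : zmod_morphism integralZ.
Proof.
move=> a b; apply/lfunP => w.
rewrite add_lfunE opp_lfunE !integralE -sumrB.
by apply: eq_bigr => e _; rewrite !ffunE rmorphB !mulrBl.
Qed.

HB.instance Definition _ :=
  GRing.isZmodMorphism.Build {ffun edge G -> int} Omega_dual
    integralZ integralZ_is_additive.

Definition in_sharp (phi : Omega_dual) : bool :=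
  `[< exists alpha : {ffun edge G -> int}, phi = integralZ alpha >].

Lemma in_sharp_zmod_closed : zmod_closed in_sharp.
Proof.
split=> [|u v /asboolP[a ->] /asboolP[b ->]]; apply/asboolP.
  by exists 0; rewrite raddf0.
by exists (a - b); rewrite raddfB.
Qed.

HB.instance Definition _ :=
  GRing.isZmodClosed.Build Omega_dual in_sharp in_sharp_zmod_closed.

Record Omega_sharp : Type :=
  OmegaSharp { sharp_val : Omega_dual; _ : in_sharp sharp_val }.

HB.instance Definition _ := [isSub for sharp_val].
HB.instance Definition _ := [Choice of Omega_sharp by <:].
HB.instance Definition _ := [SubChoice_isSubZmodule of Omega_sharp by <:].

Definition H1_image (phi : Omega_sharp) : bool :=
  `[< exists alpha : {ffun edge G -> int},
        in_H1 alpha /\ sharp_val phi = integralZ alpha >].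

Lemma H1_image_zmod_closed : zmod_closed H1_image.
Proof.
have dstarB (a b : {ffun edge G -> int}) : dstar (a - b) = dstar a - dstar b.
  apply/ffunP => x; rewrite !ffunE opprB.
  under eq_bigr do rewrite !ffunE.
  under [X in _ - X]eq_bigr do rewrite !ffunE.
  by rewrite !sumrB opprB addrACA [RHS]addrACA [- _ + _]addrC.
split=> [|u v /asboolP[a [/eqP ha hu]] /asboolP[b [/eqP hb hv]]].
  apply/asboolP; exists 0; rewrite raddf0; split=> //.
  by have := dstarB 0 0; rewrite !subrr /in_H1 => ->.
apply/asboolP; exists (a - b); split.
  by rewrite /in_H1 dstarB ha hb subrr.
by rewrite integralZ_is_additive -hu -hv.
Qed.

HB.instance Definition _ :=
  GRing.isZmodClosed.Build Omega_sharp H1_image H1_image_zmod_closed.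

Definition jacobian : zmodType :=
  Quotient.quot (GRing.ZmodClosed.clone Omega_sharp H1_image _).

End Jacobian.

Definition free_abelian_of_rank (A : zmodType) (r : nat) : Prop :=
  exists f : {additive A -> 'rV[int]_r}, bijective f.

(* Main.v *)
From HB Require Import structures.
From mathcomp Require Import all_boot all_order all_algebra.
From mathcomp Require Import all_classical all_reals.
From mathcomp Require Import topology normedtype.
From mathcomp Require Import zify lra.
Require Import Defs.

(** Under the independence hypothesis, an integral 1-chain [alpha] integrates to
    zero on every harmonic form exactly when it is supported on the bridges.
    Harmonic forms vanish on bridges, because a bridge is the only edge of some
    cut and the net flow through a cut is zero ([flow_bridge]). Conversely, an
    edge [e] which is not a bridge lies on a cycle [c], and the circulation
    around [c], which is +1 or -1 on the edges of [c] and 0 elsewhere, is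
    harmonic. Integrating it over [alpha] gives a relation with integer
    coefficients between the lengths of the edges of [c]. A cycle is a circle,
    so it stays connected when a point is removed ([cycle_two_connected]) and
    lies in a maximal 2-connected component; rational independence kills every
    coefficient of the relation, among them the one at [e]
    ([integralZ_nonbridge]).

    Hence integration identifies the Jacobian with the chains supported on the
    set [N] of the edges other than the bridges, modulo flows, which by the
    boundary map is the group of boundaries of such chains.  These are all the
    0-chains of total 0 on each connected component of the graph with edge set
    [N]; such a 0-chain is determined by its values, which are arbitrary, at the
    vertices other than one chosen root in each component ([dstar_nonroots],
    [chain_of_values]).  So the Jacobian is free, of rank the number of these
    non-root vertices.

    It remains to see that the number of non-root vertices for [N], plus the
    number of bridges, is the number of vertices minus one.  Taking chains with
    coefficients in Z/2, the boundary at the non-root vertices of the whole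
    graph and the pair made of the boundary at the non-root vertices for [N] and
    the restriction to the bridges are two surjections from the same finite set
    with the same fibres ([card_nonroots_nonbridges]). *)

Set Implicit Arguments.
Unset Strict Implicit.
Unset Printing Implicit Defensive.

Import Order.TTheory GRing.Theory Num.Theory.
Import numFieldNormedType.Exports.
Local Open Scope ring_scope.

#[local] Arguments source {R G} a.
#[local] Arguments target {R G} a.

(** * Walks and cycles *)

Section Walks.
Context {R : realType} (G : wgraph R).

(** The start is a parameter so that the empty walk has a place; the vertices
    visited are [x :: map target p]. *)
Fixpoint walk (x : vertex G) (p : seq (dart G)) : bool :=
  if p is a :: p' then (source a == x) && walk (target a) p' else true.

Definition adjacent_in (S : {set edge G}) : rel (vertex G) :=
  fun x y => [exists a : dart G,
    [&& a.1 \in S, source a == x & target a == y]].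

Lemma adjacent_inP (S : {set edge G}) x y :
  reflect (exists a : dart G, [/\ a.1 \in S, source a = x & target a = y])
          (adjacent_in S x y).
Proof.
apply: (iffP existsP) => [[a /and3P[aS /eqP ? /eqP ?]]|[a [aS <- <-]]].
  by exists a.
by exists a; rewrite aS !eqxx.
Qed.

Lemma adjacent_in_sym S : connect_sym (adjacent_in S).
Proof.
apply: symmetric_from_pre => x y /connectP[p + ->].
elim: p x => [|z p IH] x //= /andP[/adjacent_inP[[e b] [/= eS <- <-]] /IH hz].
apply: connect_trans hz (connect1 _); apply/adjacent_inP.
by exists (e, ~~ b); rewrite /source /target /=; case: b.
Qed.

Lemma adjacent_in_edge (S : {set edge G}) e :
  e \in S -> connect (adjacent_in S) (tail e) (head e).
Proof.
by move=> eS; apply/connect1/adjacent_inP; exists (e, true).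
Qed.

Lemma source_walk x p b :
  walk x p -> b \in p -> source b \in x :: map target p.
Proof.
elim: p x => [|a p IH] x //= /andP[/eqP ax /IH hp].
rewrite !inE => /predU1P[->|/hp]; first by rewrite ax eqxx.
by rewrite inE => ->; rewrite orbT.
Qed.

Lemma walk_ind x p (P : vertex G -> Prop) : walk x p -> P x ->
    (forall b, b \in p -> P (source b) -> P (target b)) ->
  forall y, y \in x :: map target p -> P y.
Proof.
elim: p x => [|a p IH] x /= => [_ Px _ y|/andP[/eqP ax wp] Px step y].
  by rewrite inE => /eqP->.
rewrite inE => /predU1P[->//|]; apply: IH => //.
  by apply: step; rewrite ?mem_head // ax.
by move=> b bp; apply: step; rewrite inE bp orbT.
Qed.

Lemma walk_sources x p :
  walk x p -> x :: map target p = rcons (map source p) (last x (map target p)).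
Proof.
by elim: p x => [|a p IH] x //= /andP[/eqP-> /IH ->].
Qed.

(** Two steps along one edge have the same pair of ends, so a walk without
    repeated vertices does not repeat edges either. *)
Lemma walk_uniq_edges x p :
  walk x p -> uniq (x :: map target p) -> uniq (map fst p).
Proof.
elim: p x => [|a p IH] x //= /andP[/eqP ax wp] /andP[xN /andP[aN up]].
rewrite (IH _ wp) /= ?aN ?up // andbT; apply/negP => /mapP[b bp eab].
have hs := source_walk wp bp.
have ht : target b \in target a :: map target p.
  by rewrite inE (map_f target bp) orbT.
case/negP: xN; rewrite -ax /source eab.
by move: hs ht; rewrite /source /target; case: ifP; case: ifP.
Qed.

Lemma connect_walk S x y : connect (adjacent_in S) x y ->
  exists p, [/\ walk x p, last x (map target p) = y,
                uniq (x :: map target p) & {subset map fst p <= S}].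
Proof.
case/connectP => q /shortenP[p hp up _] ->.
suff [r [wr tr sr]] : exists r,
    [/\ walk x r, map target r = p & {subset map fst r <= S}].
  by exists r; rewrite tr.
elim: p x hp {up q} => [|z p IH] x /=; first by exists [::].
case/andP=> /adjacent_inP[a [aS ax az]] /IH[q [wq tq sq]].
exists (a :: q); rewrite /= ax az tq wq eqxx; split=> // e.
by rewrite inE => /predU1P[->|/sq].
Qed.

Lemma cycle_walk a p :
  cycle (fun a b : dart G => target a == source b) (a :: p) =
  walk (target a) p && (last (target a) (map target p) == source a).
Proof.
rewrite /=; move: {2 5}a => b; elim: p a => [|d p IH] a /=.
  by rewrite andbT.
by rewrite IH andbA [source d == _]eq_sym.
Qed.

Lemma cycle_targets c : cycle (fun a b : dart G => target a == source b) c ->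
  map target c = rot 1 (map source c).
Proof.
case: c => [//|a p]; rewrite cycle_walk rot1_cons /= => /andP[wp /eqP<-].
exact: walk_sources.
Qed.

Lemma is_cycle_rot n c : is_cycle (rot n c) = @is_cycle R G c.
Proof.
rewrite /is_cycle rot_cycle !map_rot !rot_uniq.
by rewrite -!size_eq0 size_rot.
Qed.

(** A walk between the ends of [e] that avoids [e] would close up, together
    with [e], to a cycle. *)
Lemma bridge_cut e :
  is_bridge e -> ~~ connect (adjacent_in (~: [set e])) (head e) (tail e).
Proof.
move=> br; apply/negP => /connect_walk[p [wp lp up sp]]; apply: br.
exists ((e, true) :: p); rewrite inE eqxx; split=> //.
rewrite /is_cycle cycle_walk wp lp eqxx !andTb.
move: (up); rewrite (walk_sources wp) lp rcons_uniq => usp.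
apply/andP; split; first exact: usp.
rewrite map_cons cons_uniq (walk_uniq_edges wp up) andbT.
by apply/negP => /sp; rewrite !inE eqxx.
Qed.

End Walks.

(** * Chains, flows and cuts *)

Lemma fun_ffunB (I : finType) (A : zmodType) (u v : {ffun I -> A}) i :
  (u - v) i = u i - v i.
Proof. by rewrite !ffunE. Qed.

Section Flows.
Context {R : realType} (G : wgraph R) {A : zmodType}.
Implicit Types (u w : {ffun edge G -> A}) (S : {set edge G}).

Lemma dstar_is_additive : zmod_morphism (@dstar R G A).
Proof.
move=> u w; apply/ffunP => x; rewrite !ffunE opprB.
under eq_bigr do rewrite !ffunE.
under [X in _ - X]eq_bigr do rewrite !ffunE.
by rewrite !sumrB opprB addrACA [RHS]addrACA [- _ + _]addrC.
Qed.

HB.instance Definition _ :=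
  GRing.isZmodMorphism.Build {ffun edge G -> A} {ffun vertex G -> A}
    (@dstar R G A) dstar_is_additive.

Definition restrict S w : {ffun edge G -> A} :=
  [ffun e => if e \in S then w e else 0].

Lemma restrict_is_additive S : zmod_morphism (restrict S).
Proof.
by move=> u w; apply/ffunP => e; rewrite !ffunE; case: ifP; rewrite ?subr0.
Qed.

HB.instance Definition _ S :=
  GRing.isZmodMorphism.Build {ffun edge G -> A} {ffun edge G -> A}
    (restrict S) (restrict_is_additive S).

Lemma restrict_id S w : (forall e, e \notin S -> w e = 0) -> restrict S w = w.
Proof. by move=> w0; apply/ffunP => e; rewrite ffunE; case: ifPn => // /w0. Qed.

(** The net flow into a set of vertices is the flow through the edges entering
    it minus the flow through the edges leaving it: edges inside the set cancel.
    *)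
Lemma sum_dstar (P : pred (vertex G)) w :
  \sum_(x | P x) dstar w x =
  \sum_(e | P (head e)) w e - \sum_(e | P (tail e)) w e.
Proof.
under eq_bigr do rewrite ffunE.
rewrite sumrB; congr (_ - _).
  rewrite [RHS](partition_big head P) //=; apply: eq_bigr => x Px.
  by apply: eq_bigl => e; case: eqP => [->|]; rewrite ?Px ?andbF.
rewrite [RHS](partition_big tail P) //=; apply: eq_bigr => x Px.
by apply: eq_bigl => e; case: eqP => [->|]; rewrite ?Px ?andbF.
Qed.

(** A bridge is the only edge across the cut that it defines, and the net flow
    across a cut is zero. *)
Lemma flow_bridge w e : dstar w = 0 -> is_bridge e -> w e = 0.
Proof.
move=> w0 br; pose P := connect (adjacent_in (~: [set e])) (head e).
have := sum_dstar P w; rewrite big1 => [|x _]; last by rewrite w0 ffunE.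
rewrite (bigD1 e) /=; last exact: connect0.
rewrite [X in _ - X](_ : _ = \sum_(i | P (head i) && (i != e)) w i).
  by rewrite addrK.
apply: eq_bigl => i; case: eqVneq => [->|ie].
  by rewrite andbF; apply/negbTE/bridge_cut.
rewrite andbT; apply: same_connect_r; first exact: adjacent_in_sym.
by apply: adjacent_in_edge; rewrite !inE.
Qed.

Definition nonroots S : {set vertex G} :=
  [set x | fingraph.root (adjacent_in S) x != x].

(** A chain supported on [S] has a boundary of total 0 on each connected
    component of the graph with edge set [S], so the value at the root of the
    component follows from the others. *)
Lemma dstar_nonroots S w :
    (forall x, x \in nonroots S -> dstar (restrict S w) x = 0) ->
  dstar (restrict S w) = 0.
Proof.
move=> w0; apply/ffunP => x; rewrite [RHS]ffunE.
have [xN|] := boolP (x \in nonroots S); first exact: w0.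
rewrite inE negbK => /eqP rx.
have sc := adjacent_in_sym S.
have := sum_dstar (connect (adjacent_in S) x) (restrict S w).
(* On the support of the chain, the two ends lie in the same component. *)
rewrite [X in _ = X - _](_ : _ = \sum_(e | connect (adjacent_in S) x (tail e))
    restrict S w e); last first.
  rewrite big_mkcond [RHS]big_mkcond; apply: eq_bigr => e _; rewrite !ffunE.
  have [eS|_] := boolP (e \in S); last by rewrite !if_same.
  by rewrite (same_connect_r sc (adjacent_in_edge eS)).
rewrite subrr (bigD1 x) ?connect0 //= big1 ?addr0 // => y /andP[xy yx].
apply: w0; rewrite inE.
by move: xy; rewrite -(root_connect sc) rx => /eqP<-; rewrite eq_sym.
Qed.

(** Follow a path from [x] to [y], adding [a] or [- a] on each edge according to
    its direction. *)
Lemma chain_of_boundary S x y (a : A) : connect (adjacent_in S) x y ->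
  exists w, dstar (restrict S w) =
    [ffun z => (if z == y then a else 0) - (if z == x then a else 0)].
Proof.
case/connectP => p + ->; elim: p x => [|z p IH] x /=.
  by exists 0; rewrite !raddf0; apply/ffunP => z; rewrite !ffunE subrr.
case/andP => /adjacent_inP[[e b] [/= eS ex ez]] /IH[w hw].
pose d : {ffun edge G -> A} :=
  [ffun i => if i == e then if b then a else - a else 0].
have single (f : edge G -> vertex G) t :
    \sum_(i | f i == t) restrict S d i =
    if t == f e then if b then a else - a else 0.
  rewrite big_mkcond (bigD1 e) //= big1 => [|i /negbTE ie].
    by rewrite !ffunE eS eqxx addr0 eq_sym.
  by rewrite !ffunE ie; case: ifP => //; case: ifP.
have hd t : dstar (restrict S d) t =
    (if t == z then a else 0) - (if t == x then a else 0).
  rewrite ffunE !single -ex -ez /source /target /=.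
  by case: b {ex ez single} @d; case: ifP => _; case: ifP => _;
    rewrite ?opprK ?oppr0 ?addr0 ?add0r ?subrr ?addNr.
exists (d + w); rewrite raddfD [LHS]raddfD /= hw; apply/ffunP => t.
by rewrite [LHS]ffunE hd !ffunE addrC addrA subrK.
Qed.

(** Send the value [g x] to each vertex [x] from the root of its component; this
    disturbs the boundary only at roots. *)
Lemma chain_of_values S (g : vertex G -> A) :
  exists w, forall x, x \in nonroots S -> dstar (restrict S w) x = g x.
Proof.
have sc := adjacent_in_sym S.
have step x : exists w, dstar (restrict S w) = [ffun z =>
    (if z == x then g x else 0) -
    (if z == fingraph.root (adjacent_in S) x then g x else 0)].
  by apply: chain_of_boundary; rewrite sc connect_root.
have [W hW] := choice step.
exists (\sum_x W x) => x; rewrite inE => xN.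
rewrite !raddf_sum sum_ffunE (bigD1 x) //= hW ffunE eqxx.
rewrite eq_sym (negbTE xN) subr0 big1 ?addr0 // => y yx.
rewrite hW ffunE eq_sym (negbTE yx) [x == _](_ : _ = false) ?subrr //.
by apply: contraNF xN => /eqP ->; rewrite (root_root sc).
Qed.

End Flows.

(** * The realization of a cycle *)

Section CircleRealization.
Local Open Scope classical_set_scope.
Local Open Scope quotient_scope.
Context {R : realType} (G : wgraph R).

(** Retracting the line onto the segment of [e] makes the parametrization of an
    edge a total function of a real number, so that connectedness of intervals
    of the line applies to it directly. *)
Definition clamp (e : edge G) (u : R) : R := Num.max 0 (Num.min u (len e)).

Lemma clampP e u : `[0, len e]%classic (clamp e u).
Proof.
rewrite /= in_itv /= /clamp le_max lexx /=.
by rewrite ge_max (ltW (len_gt0 e)) ge_min lexx orbT.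
Qed.

Lemma clamp_id e u : 0 <= u <= len e -> clamp e u = u.
Proof.
by case/andP=> u0 ul; rewrite /clamp (min_idPl ul) (max_idPr u0).
Qed.

Definition edge_cell (e : edge G) (u : R) : cells G :=
  existT (@cell R G) (inr e) (exist _ (clamp e u) (mem_set (clampP e u))).

Definition point_of_cell (x : cells G) : realization G := \pi x.

Definition vertex_point v := point_of_cell (vertex_cell v).

(** The point at distance [u] from the source of [a]. *)
Definition dart_point (a : dart G) (u : R) :=
  point_of_cell (edge_cell a.1 (if a.2 then u else len a.1 - u)).

Lemma point_of_cell_eq x y :
  (point_of_cell x = point_of_cell y) <-> (attach x = attach y).
Proof.
split=> [/(@eqmodP _ (glue_equiv G))/eqP//|h].
by apply/(@eqmodP _ (glue_equiv G))/eqP.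
Qed.

Lemma continuous_dart_point a : continuous (dart_point a).
Proof.
have edge_cont (e : edge G) :
    continuous (fun u => point_of_cell (edge_cell e u)).
  move=> u; apply: (@continuous_comp _ _ _ (edge_cell e) point_of_cell);
    last exact: pi_continuous.
  apply: (@continuous_comp _ (set_type `[0, len e]%classic) (cells G)
    (fun u => exist _ (clamp e u) (mem_set (clampP e u)))
    (existT (@cell R G) (inr e))); last exact: existT_continuous.
  apply: continuous_comp_initial => {}u.
  apply: (@continuous_max R _ (cst 0) (fun u => Num.min u (len e))).
    exact: cst_continuous.
  by apply: (@continuous_min R _ id (cst (len e))) => //; exact: cst_continuous.
case: a => e [] u; rewrite /dart_point /=; first exact: edge_cont.
apply: (@continuous_comp R R _ (fun u => len e - u)
  (fun u => point_of_cell (edge_cell e u))).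
  by apply: continuousB => //; exact: cst_continuous.
exact: edge_cont.
Qed.

Lemma attach_edge_cell e u : 0 <= u <= len e ->
  attach (edge_cell e u) =
    if u == 0 then vertex_cell (tail e)
    else if u == len e then vertex_cell (head e)
    else edge_cell e u.
Proof.
move=> hu.
have -> : attach (edge_cell e u) =
    if clamp e u == 0 then vertex_cell (tail e)
    else if clamp e u == len e then vertex_cell (head e)
    else edge_cell e u by [].
by rewrite clamp_id.
Qed.

Lemma dart_point0 a : dart_point a 0 = vertex_point (source a).
Proof.
apply/point_of_cell_eq; rewrite /source.
have lt0 := len_gt0 a.1.
case: a.2; rewrite ?subr0 attach_edge_cell ?lexx ?ltW // ?eqxx //.
by rewrite gt_eqF.
Qed.

Lemma dart_point_len a : dart_point a (len a.1) = vertex_point (target a).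
Proof.
apply/point_of_cell_eq; rewrite /target.
have lt0 := len_gt0 a.1.
case: a.2; rewrite ?subrr attach_edge_cell ?lexx ?ltW // ?eqxx //.
by rewrite gt_eqF.
Qed.

Lemma vertex_point_inj : injective vertex_point.
Proof. by move=> v w /point_of_cell_eq [].  Qed.

Lemma attach_interior e u :
  0 < u < len e -> attach (edge_cell e u) = edge_cell e u.
Proof.
move=> /andP[u0 ul]; rewrite attach_edge_cell ?ltW //.
by rewrite gt_eqF // lt_eqF.
Qed.

Lemma dart_point_vertex a u v :
  0 < u < len a.1 -> dart_point a u <> vertex_point v.
Proof.
move=> hu /point_of_cell_eq; rewrite attach_interior //.
by case: a.2; lra.
Qed.

(** Recovers the parameter of an edge cell without inverting an equality of
    dependent pairs. *)
Definition coordinate (x : cells G) : R :=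
  match x with
  | existT (inl _) _ => 0
  | existT (inr e) t => set_val t
  end.

Lemma edge_cell_inj e f u v : 0 <= u <= len e -> 0 <= v <= len f ->
  edge_cell e u = edge_cell f v -> e = f /\ u = v.
Proof.
move=> hu hv h; split; first by have := congr1 (@projT1 _ _) h; case.
have hc : clamp e u = clamp f v := congr1 coordinate h.
by move: hc; rewrite !clamp_id.
Qed.

(** The last clause asks for [a = b] and not just [a.1 = b.1]: the two darts of
    one edge parametrize it in opposite directions. *)
Lemma dart_point_interior a b u v :
    0 < u < len a.1 -> 0 <= v < len b.1 -> dart_point a u = dart_point b v ->
  a.1 = b.1 /\ (a = b -> u = v).
Proof.
move=> hu hv.
have [->|v0] := eqVneq v 0.
  by rewrite dart_point0 => /(dart_point_vertex hu).
have {}v0 : 0 < v by rewrite lt_def v0; case/andP: hv.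
have hv' : 0 < v < len b.1 by lra.
have hu1 : 0 < (if a.2 then u else len a.1 - u) < len a.1 by case: a.2; lra.
have hv1 : 0 < (if b.2 then v else len b.1 - v) < len b.1 by case: b.2; lra.
move/point_of_cell_eq; rewrite !attach_interior //.
case/edge_cell_inj => [||-> h].
- by case/andP: hu1 => *; rewrite !ltW.
- by case/andP: hv1 => *; rewrite !ltW.
split=> // ab.
by move: h; rewrite ab; case: b.2 => // /addrI/oppr_inj.
Qed.

(** A piece of an edge that avoids [p] is a continuous image of an interval. *)
Lemma dart_segment (p : realization G) a s t : s <= t ->
    (forall u, s <= u <= t -> dart_point a u <> p) ->
  connected_component [set~ p] (dart_point a s) (dart_point a t).
Proof.
move=> st hp.
apply: (@connected_component_max _ _
  [set dart_point a u | u in `[s, t]%classic]).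
- by exists s => //=; rewrite in_itv /= lexx.
- by move=> _ [u + <-]; rewrite /= in_itv /=; exact: hp.
- apply: connected_continuous_connected; first exact: segment_connected.
  exact/continuous_subspaceT/continuous_dart_point.
- by exists t => //=; rewrite in_itv /= lexx andbT.
Qed.

(** In a graph covered by a cycle each vertex is the source of a dart of the
    cycle, so half-open segments suffice. *)
Lemma realization_cover (c : seq (dart G)) (y : realization G) :
    (forall v, v \in map source c) -> (forall e, e \in map fst c) ->
  exists a u, [/\ a \in c, 0 <= u < len a.1 & y = dart_point a u].
Proof.
move=> hv he.
have vertexP v : exists a u,
    [/\ a \in c, 0 <= u < len a.1 & vertex_point v = dart_point a u].
  have /mapP[a ac ->] := hv v.
  by exists a, 0; rewrite dart_point0 lexx len_gt0.
rewrite -[y]reprK -/(point_of_cell (repr y)); case: (repr y) => -[v []|e t].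
  exact: vertexP.
have -> : existT (@cell R G) (inr e) t = edge_cell e (set_val t).
  rewrite /edge_cell; congr existT; apply: val_inj => /=.
  transitivity (clamp e (set_val t)) => //; rewrite clamp_id //.
  by have := set_valP t; rewrite /= in_itv.
have : 0 <= set_val t <= len e by have := set_valP t; rewrite /= in_itv.
move: (set_val t) => u hu.
have /mapP[a ac ea] := he e; subst e.
have dp : point_of_cell (edge_cell a.1 u) =
    dart_point a (if a.2 then u else len a.1 - u).
  by rewrite /dart_point; case: a.2 => //; rewrite subKr.
rewrite dp; set w := (X in dart_point a X).
have : 0 <= w <= len a.1 by rewrite /w; case: a.2; lra.
case/andP=> w0; rewrite le_eqVlt => /predU1P[->|wl].
  by rewrite dart_point_len; exact: vertexP.
by exists a, w; rewrite w0 wl.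
Qed.

(** Cut the circle at [p]: it becomes the walk that starts just after [p] on the
    dart [a] carrying [p], runs through the other darts of the cycle and comes
    back to [p] from the other side.  Every point is joined to a base point
    [q] chosen just after [p]. *)
Lemma cycle_two_connected (c : seq (dart G)) : is_cycle c ->
    (forall v, v \in map source c) -> (forall e, e \in map fst c) ->
  two_connected G.
Proof.
move=> cyc hv he p.
have [a [t [ac ht defp]]] := realization_cover p hv he.
have [i c' rotc] := rot_to ac.
have {}hv v : v \in map source (a :: c').
  by rewrite -rotc map_rot mem_rot.
have {}he e : e \in map fst (a :: c').
  by rewrite -rotc map_rot mem_rot.
move: cyc; rewrite -(is_cycle_rot i) rotc => /and4P[_ cyc + +].
rewrite !map_cons !cons_uniq => /andP[aNs _] /andP[aNe _].
(* Any point of [a] strictly between [p] and the target would do: unlike the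
   target itself, it differs from [p] even when [a] is a loop based at [p]. *)
pose q := dart_point a ((t + len a.1) / 2).
pose joined y := connected_component [set~ p] q y.
have after u : t < u < len a.1 -> dart_point a u <> p.
  move=> hu; rewrite defp => /dart_point_interior.
  by case=> [||_ /(_ erefl)]; lra.
have source_c' b : b \in c' -> vertex_point (source b) <> p.
  move=> bc; rewrite defp; have [->|t0] := eqVneq t 0.
    rewrite dart_point0 => /vertex_point_inj sab.
    by rewrite -sab map_f in aNs.
  have {}t0 : 0 < t by rewrite lt_def t0; case/andP: ht.
  by move/esym; apply: dart_point_vertex; lra.
have on_c' b u : b \in c' -> 0 <= u < len b.1 -> dart_point b u <> p.
  move=> bc hu; have [->|u0] := eqVneq u 0.
    by rewrite dart_point0; exact: source_c'.
  have {}u0 : 0 < u by rewrite lt_def u0; case/andP: hu.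
  rewrite defp => /dart_point_interior[||ba _]; [lra|lra|].
  by rewrite -ba map_f in aNe.
have targets v : vertex_point v <> p -> joined (vertex_point v).
  have: v \in map target (a :: c') by rewrite cycle_targets // mem_rot.
  move: (cyc); rewrite cycle_walk => /andP[wc _].
  apply: (walk_ind
    (P := fun v => vertex_point v <> p -> joined (vertex_point v)) wc).
    move=> hta; rewrite -dart_point_len.
    apply: dart_segment => [|u hu]; first lra.
    have [->|ul] := eqVneq u (len a.1); first by rewrite dart_point_len.
    have {}ul : u < len a.1 by rewrite lt_neqAle ul; case/andP: hu.
    by apply: after; lra.
  move=> b bc IH htb; apply: connected_component_trans (IH (source_c' b bc)) _.
  rewrite -dart_point0 -dart_point_len.
  apply: dart_segment => [|u hu]; first exact/ltW/len_gt0.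
  have [->|ul] := eqVneq u (len b.1); first by rewrite dart_point_len.
  have {}ul : u < len b.1 by rewrite lt_neqAle ul; case/andP: hu.
  by apply: on_c' => //; lra.
suff -> : [set~ p] = connected_component [set~ p] q.
  exact: component_connected.
apply/seteqP; split; last exact: connected_component_sub.
move=> y /= yp.
have [b [u [bac hu defy]]] : exists b u,
    [/\ b \in a :: c', 0 <= u < len b.1 & y = dart_point b u].
  exact: realization_cover.
move: bac; rewrite inE => /predU1P[ba|bc]; last first.
  apply: connected_component_trans (targets _ (source_c' b bc)) _.
  rewrite defy -dart_point0; apply: dart_segment => [|w hw]; first lra.
  by apply: on_c' => //; lra.
move: hu defy; rewrite ba => hu defy {b ba}.
have [ut|tu|ut] := ltgtP u t; last first.
- by case: yp; rewrite defy ut defp.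
- have [uq|qu] := leP u ((t + len a.1) / 2).
    apply: connected_component_sym; rewrite defy.
    by apply: dart_segment => // w hw; apply: after; lra.
  rewrite defy; apply: dart_segment => [|w hw]; first exact: ltW.
  by apply: after; lra.
have before w : 0 <= w <= u -> dart_point a w <> p.
  move=> hw; rewrite defp => /esym/dart_point_interior.
  by case=> [||_ /(_ erefl)]; lra.
apply: connected_component_trans (targets (source a) _) _.
  by rewrite -dart_point0; apply: before; lra.
by rewrite defy -dart_point0; apply: dart_segment => //; lra.
Qed.

End CircleRealization.

(** * Maximal 2-connected components containing a cycle *)

Section CycleSubgraph.
Context {R : realType} (G : wgraph R) (c : seq (dart G)) (cyc : is_cycle c).

Definition cycle_vertices : {set vertex G} := [set x in map source c]%SET.
Definition cycle_edges : {set edge G} := [set e in map fst c]%SET.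

Lemma mem_cycle_targets a : a \in c -> target a \in cycle_vertices.
Proof.
move=> ac; have /and4P[_ cc _ _] := cyc.
by rewrite inE -(mem_rot 1) -cycle_targets // map_f.
Qed.

Lemma cycle_tail e : e \in cycle_edges -> tail e \in cycle_vertices.
Proof.
rewrite inE => /mapP[[f b] ac ->] /=.
have := mem_cycle_targets ac; have := map_f source ac.
by rewrite !inE /source /target /=; case: b {ac}.
Qed.

Lemma cycle_head e : e \in cycle_edges -> head e \in cycle_vertices.
Proof.
rewrite inE => /mapP[[f b] ac ->] /=.
have := mem_cycle_targets ac; have := map_f source ac.
by rewrite !inE /source /target /=; case: b {ac}.
Qed.

Lemma cycle_vertices_nonempty : (0 < #|{: {v | v \in cycle_vertices}}|)%N.
Proof.
have /and4P[c0 _ _ _] := cyc; rewrite card_sig.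
case cE: c c0 => [//|a p] _.
by apply/card_gt0P; exists (source a); rewrite !inE cE mem_head.
Qed.

Lemma cycle_connected (x y : {v | v \in cycle_vertices}) :
  connect (adjacent
    (fun e : {e | e \in cycle_edges} =>
       Sub (tail (val e)) (cycle_tail (valP e)) : {v | v \in cycle_vertices})
    (fun e : {e | e \in cycle_edges} =>
       Sub (head (val e)) (cycle_head (valP e))))
    x y.
Proof.
set r := adjacent _ _.
have rsym : connect_sym r.
  apply: sym_connect_sym => {}x {}y.
  by apply: eq_existsb => e; rewrite orbC.
have step b : b \in c -> forall hs ht,
    connect r (Sub (source b) hs) (Sub (target b) ht).
  move=> bc hs ht; apply/connect1/existsP.
  have be : b.1 \in cycle_edges by rewrite inE map_f.
  exists (Sub b.1 be); rewrite -!val_eqE /= /source /target.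
  by case: b.2; rewrite !eqxx ?orbT.
case/and4P: (cyc) => c0 cc _ _.
case cE: c c0 cc step => [//|a p] _ cc step.
have sv v : v \in cycle_vertices -> v \in target a :: map target p.
  by rewrite inE -map_cons cycle_targets // mem_rot cE.
have ha : target a \in cycle_vertices.
  by apply: mem_cycle_targets; rewrite cE mem_head.
have base v hv : connect r (Sub (target a) ha) (Sub v hv).
  move: (cc); rewrite cycle_walk => /andP[wp _].
  pose P v := forall hv, connect r (Sub (target a) ha) (Sub v hv).
  apply: (walk_ind (P := P) wp _ _ (sv v hv)) => [h|b bp IH h].
    by rewrite (bool_irrelevance h ha).
  have bc : b \in a :: p by rewrite inE bp orbT.
  have hs : source b \in cycle_vertices by rewrite inE cE map_f.
  exact: connect_trans (IH hs) (step b bc hs h).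
case: x y => [x hx] [y hy].
by apply: connect_trans (base y hy); rewrite rsym; exact: base.
Qed.

Definition cycle_subgraph : subgraph G :=
  Subgraph cycle_vertices_nonempty cycle_connected.

Lemma cycle_subgraph_two_connected : two_connected cycle_subgraph.
Proof.
pose embed (d : dart cycle_subgraph) : dart G := (val d.1, d.2).
(* [d] is the cycle [c] read inside the subgraph. *)
have [d dE] : exists d, map embed d = c.
  have : all (mem c) c by apply/allP.
  elim: {2 3}c => [|[e b] q IH] /=; first by exists [::].
  case/andP=> ac /IH[d <-].
  have ec : e \in cycle_edges by rewrite inE; exact: (map_f fst ac).
  by exists ((Sub e ec, b) :: d).
have vsource a : source (embed a) = val (source a).
  by case: a => e [].
have vtarget a : target (embed a) = val (target a).
  by case: a => e [].
have sources : map source c = map val (map source d).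
  by rewrite -dE -!map_comp; apply: eq_map.
have edges : map fst c = map val (map fst d) by rewrite -dE -!map_comp.
apply: (@cycle_two_connected _ _ d).
- move: cyc; rewrite /is_cycle sources edges !(map_inj_uniq val_inj) -dE.
  rewrite cycle_map; congr [&& _, _, _ & _]; first by case: (d).
  by apply: eq_cycle => a b /=; rewrite vsource vtarget val_eqE.
- by move=> v; rewrite -(mem_map val_inj) -sources; have := valP v; rewrite inE.
- by move=> e; rewrite -(mem_map val_inj) -edges; have := valP e; rewrite inE.
Qed.

End CycleSubgraph.

(** Enlarging a 2-connected subgraph must stop, as the number of vertices and
    edges strictly increases. *)
Lemma maximal_two_connected_above (R : realType) (G : wgraph R)
    (H : subgraph G) : two_connected H ->
  exists K : subgraph G, maximal_two_connected K /\ sub_subgraph H K.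
Proof.
pose size_of (K : subgraph G) := (#|svertex K| + #|sedge K|)%N.
have bound K : (size_of K <= #|vertex G| + #|edge G|)%N.
  by apply: leq_add; exact: max_card.
have [n] := ubnP ((#|vertex G| + #|edge G|) - size_of H)%N.
elim: n H => // n IH H lt_n tH.
have [max|] := pselect (forall K : subgraph G,
  two_connected K -> sub_subgraph H K -> sub_subgraph K H).
  by exists H; split=> //; rewrite /sub_subgraph !subxx.
move/existsNP => [K /not_implyP[tK /not_implyP[HK KH]]].
have [|L [mL KL]] := IH K _ tK; last first.
  exists L; split=> //; case/andP: HK KL => vHK eHK /andP[vKL eKL].
  rewrite /sub_subgraph (fintype.subset_trans vHK) //.
  exact: fintype.subset_trans eHK eKL.
suff : (size_of H < size_of K)%N by have := bound K; have := bound H; lia.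
case/andP: HK => vHK eHK; have := subset_leq_card vHK.
have := subset_leq_card eHK; rewrite /size_of => le1 le2.
rewrite ltn_neqAle leq_add // andbT; apply/eqP => eq_size.
have ev : svertex H == svertex K by rewrite eqEcard vHK; lia.
have ee : sedge H == sedge K by rewrite eqEcard eHK; lia.
by apply: KH; rewrite /sub_subgraph (eqP ev) (eqP ee) !subxx.
Qed.

(** * Integration *)

Section Integration.
Context {R : realType} (G : wgraph R).

Definition circulation (c : seq (dart G)) (e : edge G) : int :=
  \sum_(a <- c | a.1 == e) (if a.2 then 1 else -1).

(** A closed walk enters each vertex as many times as it leaves it. *)
Lemma circulation_flow c : cycle (fun a b : dart G => target a == source b) c ->
  dstar [ffun e => circulation c e] = 0.
Proof.
move=> cc; apply/ffunP => x; rewrite !ffunE.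
have sumE (f : edge G -> vertex G) :
    \sum_(e | f e == x) [ffun e => circulation c e] e =
    \sum_(a <- c | f a.1 == x) (if a.2 then 1 else -1).
  under eq_bigr do rewrite ffunE.
  rewrite (exchange_big_dep predT) //= [RHS]big_mkcond; apply: eq_bigr => a _.
  have [fax|nfax] := boolP (f a.1 == x); last first.
    rewrite big_pred0 // => e; apply/negP => /andP[/eqP fe /eqP ae].
    by rewrite ae fe eqxx in nfax.
  rewrite (big_pred1 a.1) // => e /=; rewrite andbC [in RHS]eq_sym.
  by case: (eqVneq a.1 e) => [<-|//].
transitivity (\sum_(a <- c | target a == x) (1 : int) -
    \sum_(a <- c | source a == x) 1); last first.
  rewrite -(big_map source (eq_op^~ x) (fun=> 1)).
  rewrite -(big_map target (eq_op^~ x) (fun=> 1)) cycle_targets //.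
  by apply/eqP; rewrite subr_eq0; apply/eqP/perm_big; rewrite perm_rot.
rewrite !sumE (big_mkcond (fun a => head a.1 == x)).
rewrite (big_mkcond (fun a => tail a.1 == x)).
rewrite (big_mkcond (fun a => target a == x)).
rewrite (big_mkcond (fun a => source a == x)) -!sumrB.
apply: eq_bigr => -[e b] _; rewrite /source /target /=.
by case: b; case: ifP => _; case: ifP => _; rewrite ?opprK ?oppr0 ?addr0 ?add0r.
Qed.

Lemma circulation_out c e : e \notin map fst c -> circulation c e = 0.
Proof.
move=> ec; rewrite /circulation big_seq_cond big1 // => a /andP[ac /eqP ae].
by rewrite -ae map_f in ec.
Qed.

(** Only one dart of the cycle runs along [e], so nothing can cancel. *)
Lemma circulation_neq0 c e : is_cycle c -> e \in map fst c ->
  circulation c e != 0.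
Proof.
case/and4P=> _ _ _ + /mapP[a ac ->].
rewrite (perm_uniq (perm_map fst (perm_to_rem ac))) /= => /andP[aN _].
rewrite /circulation (big_rem a) //= eqxx.
have := circulation_out aN; rewrite /circulation => ->.
by case: a.2.
Qed.

Lemma integralZ_eq0P (alpha : {ffun edge G -> int}) :
  integralZ alpha = 0 <->
  forall omega : {ffun edge G -> R^o}, dstar omega = 0 ->
    \sum_e (alpha e)%:~R * omega e * len e = 0.
Proof.
split=> [al0 omega om0|al0].
  have om : omega \in Omega G by rewrite memv_ker lfunE /=; apply/eqP.
  have := congr1 (fun f : 'Hom(_, R^o) => f (vsproj (Omega G) omega)) al0.
  rewrite zero_lfunE integralE vsprojK //= => h; rewrite -[RHS]h.
  by apply: eq_bigr => e _; rewrite ffunE.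
apply/lfunP => w; rewrite integralE zero_lfunE.
have om : dstar (vsval w) = 0.
  by have := subvsP w; rewrite memv_ker lfunE /= => /eqP.
rewrite -[RHS](al0 _ om).
by apply: eq_bigr => e _; rewrite ffunE.
Qed.

Lemma integralZ_bridges (alpha : {ffun edge G -> int}) :
  (forall e, e \notin bridges G -> alpha e = 0) -> integralZ alpha = 0.
Proof.
move=> al0; apply/integralZ_eq0P => omega om0; apply: big1 => e _.
have [|/al0->] := boolP (e \in bridges G); last by rewrite !mul0r.
by rewrite inE => /asboolP/(flow_bridge om0)->; rewrite mulr0 mul0r.
Qed.

(** Integrating the circulation around a cycle through [e] over [alpha] gives a
    relation between the edge lengths of a maximal 2-connected component that
    contains the cycle; its coefficient at [e] is [alpha e] up to sign. *)
Lemma integralZ_nonbridge (alpha : {ffun edge G -> int}) e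
    (indep : forall H : subgraph G, maximal_two_connected H ->
       rat_independent (fun e : edge H => len e)) :
  integralZ alpha = 0 -> e \notin bridges G -> alpha e = 0.
Proof.
move=> /integralZ_eq0P al0; rewrite inE => /asboolPn/contrapT[c [cyc ec]].
have [K [maxK /andP[_ cK]]] :=
  maximal_two_connected_above (cycle_subgraph_two_connected (cyc := cyc)).
have subK f : f \in map fst c -> f \in sedge K.
  by move=> fc; apply: (fintype.subsetP cK); rewrite inE.
pose x f : int := alpha f * circulation c f.
suff : \sum_(f : edge K) ratr (x (val f))%:~R * len f = 0.
  move/(indep K maxK (fun f => (x (val f))%:~R))/(_ (Sub e (subK e ec))).
  move/eqP.
  rewrite intr_eq0 mulf_eq0 (negbTE (circulation_neq0 cyc ec)) orbF.
  by move/eqP.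
have /al0 circ0 :
    dstar ([ffun f => (circulation c f)%:~R] : {ffun _ -> R^o}) = 0.
  apply/ffunP => v; have /and4P[_ /circulation_flow/ffunP/(_ v) + _ _] := cyc.
  rewrite !ffunE => /(congr1 (fun n : int => n%:~R : R)).
  rewrite rmorphB /= !rmorph_sum /= => h; rewrite -[RHS]h.
  by congr (_ - _); apply: eq_bigr => f _; rewrite !ffunE.
rewrite -[RHS]circ0.
rewrite -(big_sub (sedge K) (fun f => ratr (x f)%:~R * len f)) /=.
rewrite big_mkcond; apply: eq_bigr => f _; rewrite ffunE ratr_int rmorphM /=.
case: ifPn => // fK; rewrite circulation_out ?mulr0 ?mul0r //.
by apply: contra fK; exact: subK.
Qed.

End Integration.

(** * Counting the non-root vertices *)

Section Rank.
Context {R : realType} (G : wgraph R).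

Lemma leq_card_fibres (X Y Z : finType) (f : X -> Y) (g : X -> Z) :
    (forall y, exists x, f x = y) -> (forall u v, g u = g v -> f u = f v) ->
  (#|Y| <= #|Z|)%N.
Proof.
move=> /choice[s sK] fg; apply: (@leq_card _ _ (g \o s)) => y z /fg.
by rewrite !sK.
Qed.

Lemma eq_card_fibres (X Y Z : finType) (f : X -> Y) (g : X -> Z) :
    (forall y, exists x, f x = y) -> (forall z, exists x, g x = z) ->
    (forall u v, f u = f v <-> g u = g v) ->
  #|Y| = #|Z|.
Proof.
move=> f_onto g_onto fg; apply/eqP; rewrite eqn_leq.
by rewrite (leq_card_fibres f_onto (fun u v => (fg u v).2))
  (leq_card_fibres g_onto (fun u v => (fg u v).1)).
Qed.

Lemma card_nonroots_setT : #|nonroots [set: edge G]%SET| = #|vertex G|.-1.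
Proof.
set S := [set: edge G]%SET.
have conn x y : connect (adjacent_in S) x y.
  move: (wgraph_connected x y); apply: connect_sub => {}x {}y /existsP[e exy].
  apply/connect1/adjacent_inP; case/orP: exy => /andP[/eqP ex /eqP ey].
    by exists (e, true).
  by exists (e, false).
have /card_gt0P[v _] := vertex_nonempty G.
have -> : nonroots S = [set~ fingraph.root (adjacent_in S) v]%SET.
  apply/setP => x; rewrite !inE eq_sym.
  by rewrite (fingraph.rootP (adjacent_in_sym S) (conn x v)).
by rewrite cardsC1.
Qed.

(** The two surjections [f] and [g] below have the same fibres: since flows
    vanish on bridges, a chain is a flow exactly when it vanishes on the bridges
    and its restriction to the other edges is a flow. *)
Lemma card_nonroots_nonbridges :
  (#|nonroots (~: bridges G)| + #|bridges G|)%N = #|vertex G|.-1.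
Proof.
rewrite -card_nonroots_setT; set N := (~: bridges G)%SET; set S := [set: _]%SET.
pose T := {ffun edge G -> 'I_2}.
pose f (u : T) : {ffun {x | x \in nonroots N} -> 'I_2} *
                 {ffun {e | e \in bridges G} -> 'I_2} :=
  ([ffun x => dstar (restrict N u) (val x)], [ffun e => u (val e)]).
pose g (u : T) : {ffun {x | x \in nonroots S} -> 'I_2} :=
  [ffun x => dstar u (val x)].
have restrictT (u : T) : restrict S u = u.
  by apply: restrict_id => e; rewrite inE.
have f_onto y : exists u, f u = y.
  case: y => yN yB.
  pose h x := if insub x is Some x' then yN x' else 0.
  have [w hw] := chain_of_values N h.
  pose u : T := [ffun e => if insub e is Some e' then yB e' else w e].
  exists u; rewrite /f; congr pair; apply/ffunP => z; rewrite ffunE; last first.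
    by rewrite ffunE valK.
  have -> : restrict N u = restrict N w.
    apply/ffunP => e; rewrite !ffunE; case: ifP => // eN.
    by rewrite insubN; move: eN; rewrite ?inE.
  by rewrite hw ?(valP z) // /h valK.
have g_onto z : exists u, g u = z.
  pose h x := if insub x is Some x' then z x' else 0.
  have [w hw] := chain_of_values S h; exists w; apply/ffunP => x.
  by rewrite ffunE -(restrictT w) hw ?(valP x) // /h valK.
have gP u v : g u = g v <-> dstar (u - v) = 0.
  rewrite raddfB /=; split=> [guv|/subr0_eq uv]; last by rewrite /g uv.
  rewrite -raddfB -(restrictT (u - v)); apply: dstar_nonroots => x xS.
  have : g u (Sub x xS) = g v (Sub x xS) by rewrite guv.
  rewrite [LHS]ffunE [RHS]ffunE /= => uvx.
  by rewrite restrictT raddfB fun_ffunB uvx subrr.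
have fP u v : f u = f v <-> dstar (u - v) = 0.
  split=> [[fN fB]|uv].
    have <- : restrict N (u - v) = u - v.
      apply: restrict_id => e; rewrite inE negbK => eB.
      have : (f u).2 (Sub e eB) = (f v).2 (Sub e eB) by rewrite /f /= fB.
      by rewrite [LHS]ffunE [RHS]ffunE /= fun_ffunB => ->; rewrite subrr.
    apply: dstar_nonroots => x xN.
    have : (f u).1 (Sub x xN) = (f v).1 (Sub x xN) by rewrite /f /= fN.
    rewrite [LHS]ffunE [RHS]ffunE /= => uvx.
    by rewrite !raddfB fun_ffunB uvx subrr.
  have uvB e : e \in bridges G -> u e = v e.
    rewrite inE => /asboolP/(flow_bridge uv); rewrite fun_ffunB.
    exact: subr0_eq.
  have uvN : dstar (restrict N u) = dstar (restrict N v).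
    have Nuv : restrict N u - restrict N v = u - v.
      rewrite -raddfB /= restrict_id // => e.
      by rewrite inE negbK fun_ffunB => /uvB ->; rewrite subrr.
    by apply: subr0_eq; rewrite -raddfB Nuv.
  rewrite /f uvN; congr pair; apply/ffunP => e; rewrite !ffunE.
  exact/uvB/valP.
have := eq_card_fibres f_onto g_onto (fun u v =>
  iff_trans (fP u v) (iff_sym (gP u v))).
rewrite card_prod !card_ffun !card_sig card_ord -expnD.
by move/eqP; rewrite eqn_exp2l // => /eqP.
Qed.

End Rank.

(** * The Jacobian as a quotient of chains *)

(** Two surjections with the same kernel have isomorphic targets. *)
Lemma free_abelian_of_same_kernel (X A : zmodType) (r : nat)
    (q : {additive X -> A}) (f : {additive X -> 'rV[int]_r}) :
    (forall a, exists x, q x = a) -> (forall y, exists x, f x = y) ->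
    (forall x, q x = 0 <-> f x = 0) ->
  free_abelian_of_rank A r.
Proof.
move=> /choice[s sK] f_onto qf.
have fs x : f (s (q x)) = f x.
  apply: subr0_eq; rewrite -raddfB; apply/qf.
  by rewrite raddfB /= sK subrr.
pose h a := f (s a).
have h_add : zmod_morphism h.
  by move=> a b; rewrite /h -{1}(sK a) -{1}(sK b) -raddfB fs raddfB.
pose hA := GRing.isZmodMorphism.Build A _ h h_add.
pose H : {additive A -> 'rV[int]_r} := HB.pack h hA.
have [t tK] := choice f_onto.
exists H; exists (fun y => q (t y)) => [a|y]; last by rewrite /= /h fs tK.
rewrite /= -[RHS]sK; apply: subr0_eq; rewrite -raddfB; apply/qf.
by rewrite raddfB /= tK subrr.
Qed.

Section JacobianClass.
Context {R : realType} (G : wgraph R).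

Definition sharp_class (alpha : {ffun edge G -> int}) : Omega_sharp G :=
  OmegaSharp (asboolT (ex_intro _ alpha erefl)).

Lemma sharp_class_is_additive : zmod_morphism sharp_class.
Proof. by move=> a b; apply: val_inj; exact: raddfB. Qed.

HB.instance Definition _ :=
  GRing.isZmodMorphism.Build {ffun edge G -> int} (Omega_sharp G)
    sharp_class sharp_class_is_additive.

Definition jacobian_class (alpha : {ffun edge G -> int}) : jacobian G :=
  (\pi_(jacobian G) (sharp_class alpha))%qT.

Lemma jacobian_class_is_additive : zmod_morphism jacobian_class.
Proof. by move=> a b; rewrite /jacobian_class !raddfB. Qed.

HB.instance Definition _ :=
  GRing.isZmodMorphism.Build {ffun edge G -> int} (jacobian G)
    jacobian_class jacobian_class_is_additive.

Lemma jacobian_class_onto (a : jacobian G) :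
  exists alpha, jacobian_class alpha = a.
Proof.
rewrite -[a]reprK; case: (repr a) => phi phiP.
have /asboolP[alpha phiE] := phiP.
by exists alpha; congr (\pi _)%qT; apply: val_inj.
Qed.

Lemma jacobian_class_eq0P (alpha : {ffun edge G -> int}) :
  jacobian_class alpha = 0 <->
  exists beta : {ffun edge G -> int},
    dstar beta = 0 /\ integralZ alpha = integralZ beta.
Proof.
have -> : jacobian_class alpha = 0 <-> H1_image (sharp_class alpha).
  rewrite /jacobian_class -[X in _ = X](raddf0 (\pi_(jacobian G))%qT).
  split=> [/eqP|h]; last apply/eqP.
    by rewrite -Quotient.idealrBE subr0.
  by rewrite -Quotient.idealrBE subr0.
split=> [/asboolP[beta [/eqP b0 ab]]|[beta [b0 ab]]]; first by exists beta.
by apply/asboolP; exists beta; split=> //; apply/eqP.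
Qed.

End JacobianClass.

Theorem theorem2p16 (R : realType) (G : wgraph R)
  (indep : forall H : subgraph G, maximal_two_connected H ->
     rat_independent (fun e : edge H => len e)) :
  exists r : nat,
    r%:Z = #|vertex G|%:Z - #|bridges G|%:Z - 1 /\
    free_abelian_of_rank (jacobian G) r.
Proof.
pose N := (~: bridges G)%SET.
exists #|nonroots N|; split.
  have := card_nonroots_nonbridges G; have := vertex_nonempty G.
  by rewrite -/N; lia.
pose f (alpha : {ffun edge G -> int}) : 'rV[int]_(#|nonroots N|) :=
  \row_i dstar (restrict N alpha) (enum_val i).
have f_add : zmod_morphism f.
  by move=> a b; apply/rowP => i; rewrite !mxE !raddfB fun_ffunB.
pose fA := GRing.isZmodMorphism.Build _ _ f f_add.
pose F : {additive {ffun edge G -> int} -> 'rV[int]_(#|nonroots N|)} :=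
  HB.pack f fA.
apply: (@free_abelian_of_same_kernel _ _ _ (@jacobian_class R G) F).
- exact: jacobian_class_onto.
- move=> y.
  have [w hw] := chain_of_values N (fun x => \sum_(i | enum_val i == x) y 0 i).
  exists w; apply/rowP => i; rewrite mxE hw ?enum_valP // (big_pred1 i) // => j.
  exact: inj_eq enum_val_inj j i.
move=> alpha.
(* The kernel of integration consists of the chains supported on bridges. *)
have restrictB (beta : {ffun edge G -> int}) :
    integralZ alpha = integralZ beta <-> restrict N alpha = restrict N beta.
  split=> [ab|ab].
    apply: subr0_eq; rewrite -raddfB; apply/ffunP => e; rewrite !ffunE.
    case: ifP => //; rewrite inE => eN.
    have := @integralZ_nonbridge _ _ (alpha - beta) e indep.
    by rewrite fun_ffunB; apply=> //; rewrite raddfB /= ab subrr.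
  apply: subr0_eq; rewrite -raddfB; apply: integralZ_bridges => e eB.
  have : restrict N alpha e = restrict N beta e by rewrite ab.
  by rewrite fun_ffunB [LHS]ffunE [RHS]ffunE inE eB => ->; rewrite subrr.
apply: (iff_trans (jacobian_class_eq0P alpha)); split.
  case=> beta [b0 /restrictB ab]; apply/rowP => i; rewrite !mxE ab.
  rewrite restrict_id ?b0 ?ffunE // => e; rewrite inE negbK inE.
  by move=> /asboolP; exact: flow_bridge.
move=> fa0; exists (restrict N alpha); split.
  apply: dstar_nonroots => x xN.
  have := congr1 (fun y : 'rV_ _ => y 0 (enum_rank_in xN x)) fa0.
  by rewrite !mxE enum_rankK_in.
apply/restrictB/ffunP => e; rewrite !ffunE; by case: (e \in N).
Qed.
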